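(* There exists $n_0$ such that for all integers $n \geqslant n_0$ the following holds: the maximum possible cardinality of a set $\mathcal{M} \subset \{0,\pm 1\}^n$ such that $(m,m)=4$ for every $m \in \mathcal{M}$, and $(m_1,m_2) \in \{-4,-3,-2,-1,0,3\}$ for any two distinct vectors $m_1,m_2 \in \mathcal{M}$, is equal to $8n-48$.
   Context: $(\cdot,\cdot)$ denotes the standard inner product on $\mathbb{R}^n$. *)

(* Defs.v *)
From HB Require Import structures.
From mathcomp Require Import all_boot all_order all_algebra.

Set Implicit Arguments.
Unset Strict Implicit.
Unset Printing Implicit Defensive.

Import GRing.Theory Num.Theory.
Local Open Scope ring_scope.

(* The set {0, 1, -1} as a finite subtype of int. *)
Definition sign0 : Type := seq_sub [:: 0; 1; -1 : int].
#[warnings="-redundant-canonical-projection"]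
HB.instance Definition _ := SubFinite.on sign0.

Definition signvec (n : nat) : Type := {ffun 'I_n -> sign0}.
#[warnings="-redundant-canonical-projection"]
HB.instance Definition _ (n : nat) := Finite.on (signvec n).

(* The standard inner product on R^n, computed in int since the coordinates
   are integers. *)
Definition inner (n : nat) (u v : signvec n) : int :=
  \sum_(i < n) val (u i) * val (v i).

Definition admissible (n : nat) (M : {set signvec n}) : bool :=
  [forall m in M, inner m m == 4]
  && [forall m1 in M, forall m2 in M,
        (m1 != m2) ==>
          (inner m1 m2 \in [:: - 4; - 3; - 2; - 1; 0; 3 : int])].

(* Main.v *)
Require Import Defs.
From mathcomp Require Import all_boot all_order all_algebra.
From mathcomp Require Import zify.

Set Implicit Arguments.
Unset Strict Implicit.
Unset Printing Implicit Defensive.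

Import Order.TTheory GRing.Theory Num.Theory.

(* Write the vectors as 4-sets of signed coordinates. On an admissible set M,
   having a positive product is an equivalence relation, and members of
   different classes have product at most 0. A class C meets |cov C| signed
   coordinates; it is either a sunflower with a 3-element core, and then
   |cov C| >= |C| + 3, or it lives on a signed 5-set, and then
   |C| <= 5 <= |cov C|. The representatives at s of the N(s) classes meeting a
   signed coordinate s are pairwise obtuse and all contain s, so
   N(s)^2 <= 4 N(s), that is N(s) <= 4. Summing,
     8n - |M| = sum_C (|cov C| - |C|) + sum_s (4 - N(s)) =: deficit.
   Suppose the deficit is less than 48. For n large some i has
   N(i, +) = N(i, -) = 4 with all classes involved being big sunflowers having i
   as a petal. The four cores T_k at (i, +) are pairwise at product -1, hence
   sum to 0; so do the four cores U_l at (i, -). As a big sunflower has petals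
   far from any given vector, T_k.U_l <= 0, whence T_k.U_l = 0, and every member
   of M outside these eight classes is orthogonal to all T_k and U_l. This
   forces N(s) + g(s) <= 4, where g(s) is the number of these eight cores containing s,
   and the deficit is at least 8 * 3 + sum_s g(s) = 24 + 24.
   Equality: sign vectors with product 1 on two fixed triples of coordinates,
   completed by +e_j for the first triple and by -e_j for the second. *)

(** * Integer inner product and norm bounds for obtuse families *)

Section DotProduct.
Local Open Scope ring_scope.
Variable n : nat.
Implicit Types u v w e : 'rV[int]_n.

Definition dot u v : int := \sum_i u 0 i * v 0 i.

Lemma dotC u v : dot u v = dot v u.
Proof. by apply: eq_bigr => i _; rewrite mulrC. Qed.

Lemma dotDl u v w : dot (u + v) w = dot u w + dot v w.
Proof. by rewrite -big_split; apply: eq_bigr => i _; rewrite mxE mulrDl. Qed.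

Lemma dotDr u v w : dot w (u + v) = dot w u + dot w v.
Proof. by rewrite dotC dotDl !(dotC w). Qed.

Lemma dotZl (a : int) u v : dot (a *: u) v = a * dot u v.
Proof. by rewrite /dot mulr_sumr; apply: eq_bigr => i _; rewrite mxE mulrA. Qed.

Lemma dotZr (a : int) u v : dot u (a *: v) = a * dot u v.
Proof. by rewrite dotC dotZl dotC. Qed.

Definition dotE := (dotDl, dotDr, dotZl, dotZr).

Lemma dot0l u : dot 0 u = 0.
Proof. by rewrite -(scale0r 0) dotZl mul0r. Qed.

Lemma dot_suml (I : Type) (r : seq I) (P : pred I) (F : I -> 'rV[int]_n) u :
  dot (\sum_(i <- r | P i) F i) u = \sum_(i <- r | P i) dot (F i) u.
Proof.
exact: (big_morph (fun v => dot v u) (fun v w => dotDl v w u) (dot0l u)).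
Qed.

Lemma dot_sumr (I : Type) (r : seq I) (P : pred I) (F : I -> 'rV[int]_n) u :
  dot u (\sum_(i <- r | P i) F i) = \sum_(i <- r | P i) dot u (F i).
Proof. by rewrite dotC dot_suml; under eq_bigr do rewrite dotC. Qed.

Lemma dot_ge0 u : 0 <= dot u u.
Proof. by apply: sumr_ge0 => i _; rewrite -expr2 sqr_ge0. Qed.

Lemma dot_eq0 u : dot u u = 0 -> u = 0.
Proof.
move=> /psumr_eq0P h; apply/rowP => i; rewrite mxE.
have /eqP := h (fun i _ => sqr_ge0 (u 0 i)) i isT.
by rewrite mulf_eq0 orbb => /eqP.
Qed.

Lemma dot_sqr_le e u : dot e e = 1 -> dot e u ^+ 2 <= dot u u.
Proof.
move=> ee; have := dot_ge0 (u + (- dot e u) *: e).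
rewrite !dotE ee (dotC u e) expr2; nia.
Qed.

Lemma dot_sum_le (I : finType) (K : {set I}) (z : I -> 'rV[int]_n) (r : int) :
  {in K &, forall k l, k != l -> dot (z k) (z l) <= r} ->
  dot (\sum_(k in K) z k) (\sum_(k in K) z k)
    <= \sum_(k in K) dot (z k) (z k) + r * (#|K| * #|K|.-1)%:R.
Proof.
move=> zr; rewrite dot_suml natrM mulrCA -sum1_card natr_sum mulr_suml.
rewrite -big_split.
apply: ler_sum => k kK; rewrite dot_sumr (bigD1 k) //= lerD2l mul1r sum1_card.
apply: le_trans (_ : \sum_(l in K :\ k) r <= _).
  rewrite (eq_bigl (mem (K :\ k))) => [|l]; last by rewrite !inE andbC.
  by apply: ler_sum => l; rewrite !inE => /andP[lk lK]; rewrite zr // eq_sym.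
by rewrite sumr_const (cardsD1 k K) kK add1n mulr_natr.
Qed.

(** The sum of the [z k] has product [a * #|K|] with the unit vector [e], and obtuseness bounds its
    norm by the sum of the [q k]. This is the tool for counting the classes that meet a signed
    coordinate. *)
Lemma sum_coord_le (I : finType) (K : {set I}) (z : I -> 'rV[int]_n) e
    (a : int) (q : I -> int) :
  dot e e = 1 -> {in K &, forall k l, k != l -> dot (z k) (z l) <= 0} ->
  {in K, forall k, dot e (z k) = a /\ dot (z k) (z k) = q k} ->
  (a * #|K|%:R) ^+ 2 <= \sum_(k in K) q k.
Proof.
move=> ee z0 zK; have -> : a * #|K|%:R = dot e (\sum_(k in K) z k).
  rewrite dot_sumr (eq_bigr (fun=> a)) => [|k /zK[]//].
  by rewrite sumr_const mulr_natr.
apply: le_trans (dot_sqr_le _ ee) _; have := dot_sum_le z0.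
by rewrite mul0r addr0 (eq_bigr q) // => k /zK[].
Qed.

(* The vectors [z k - t] are orthonormal, so [w] cannot have a product at most
   [-1] with more than [dot w w] of them. *)
Lemma dot_core_le0 (I : finType) (C : {set I}) (z : I -> 'rV[int]_n) t w :
  dot t t = 3 -> {in C, forall k, dot (z k) (z k) = 4 /\ dot (z k) t = 3} ->
  {in C &, forall k l, k != l -> dot (z k) (z l) = 3} ->
  {in C, forall k, dot w (z k) <= 0} -> dot w w < #|C|%:R -> dot w t <= 0.
Proof.
move=> tt zz zC wz wC; rewrite leNgt; apply/negP => wt.
pose y k := z k + (-1) *: t.
have yy : {in C &, forall k l, k != l -> dot (y k) (y l) <= 0}.
  move=> k l kC lC kl; rewrite !dotE tt (zC k l kC lC kl) (dotC t).
  by rewrite (zz k kC).2 (zz l lC).2.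
have := dot_sum_le yy; rewrite mul0r addr0.
rewrite (eq_bigr (fun=> 1)); last first.
  by move=> k kC; rewrite !dotE tt (dotC t) !(zz k kC).1 (zz k kC).2.
rewrite sumr_const => ys.
have wy : dot w (\sum_(k in C) y k) <= - #|C|%:R.
  rewrite dot_sumr -mulNrn -sumr_const; apply: ler_sum => k kC.
  by rewrite !dotE; have := wz k kC; lia.
(* This norm is at most [dot w w - 2 * #|C| + #|C|], which is negative. *)
have := dot_ge0 (w + \sum_(k in C) y k).
rewrite !dotE (dotC _ w); lia.
Qed.

End DotProduct.

(** * Sign vectors as sets of signed coordinates *)

Section SignedSets.
Local Open Scope ring_scope.
Variable n : nat.
Local Notation coord := ('I_n * bool)%type.
Implicit Types (A B : {set coord}) (s : coord).

(* The pair [(i, true)] stands for the unit vector e_i and [(i, false)] for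
   - e_i. *)
Definition vec A : 'rV[int]_n :=
  \row_i (((i, true) \in A)%:R - ((i, false) \in A)%:R).

Definition flip s : coord := (s.1, ~~ s.2).

(** Excludes pairs of opposite signed coordinates, which would cancel in [vec]. *)
Definition consistent A := [disjoint A & flip @^-1: A].

Lemma dot_vec A B :
  dot (vec A) (vec B) = #|A :&: B|%:R - #|A :&: flip @^-1: B|%:R.
Proof.
have cardE (X : {set coord}) :
    #|X|%:R = \sum_(i < n) (((i, true) \in X)%:R + ((i, false) \in X)%:R) :> int.
  rewrite -sum1_card natr_sum big_mkcond /= (eq_bigr (fun s => (s \in X)%:R)).
    rewrite (eq_bigr (fun s => ((s.1, s.2) \in X)%:R)); last by case.
    rewrite -(pair_bigA _ (fun i b => ((i, b) \in X)%:R)) /=.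
    by apply: eq_bigr => i _; rewrite big_bool.
  by move=> s _; case: ifP.
rewrite !cardE -sumrB; apply: eq_bigr => i _; rewrite !mxE !inE /flip /=.
by do 4 case: (_ \in _).
Qed.

Lemma dot_vec_sub A B : consistent A -> B \subset A ->
  dot (vec A) (vec B) = #|B|%:R.
Proof.
move=> cA BA; rewrite dot_vec (setIidPr BA).
suff -> : A :&: flip @^-1: B = set0 by rewrite cards0 subr0.
apply/eqP; rewrite setI_eq0; apply: disjointWr cA.
exact: preimsetS.
Qed.

Lemma consistent_sub A B : consistent A -> B \subset A -> consistent B.
Proof.
by move=> cA BA; apply: disjointW cA => //; apply: preimsetS.
Qed.

Lemma dot_unit s A :
  dot (vec [set s]) (vec A) = (s \in A)%:R - (flip s \in A)%:R.
Proof.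
have card1I X : #|[set s] :&: X| = (s \in X).
  case sX: (s \in X); first by rewrite (setIidPl _) ?sub1set ?cards1.
  by apply/eqP; rewrite cards_eq0 setI_eq0 disjoints1 sX.
by rewrite dot_vec !card1I inE.
Qed.

Lemma consistentP A s : consistent A -> s \in A -> flip s \notin A.
Proof. by move=> cA sA; have := disjointFr cA sA; rewrite inE => ->. Qed.

Lemma dot_unit_in s A : consistent A -> s \in A ->
  dot (vec [set s]) (vec A) = 1.
Proof. by move=> cA sA; rewrite dot_unit sA (negPf (consistentP cA sA)). Qed.

Lemma dot_unit1 s : dot (vec [set s]) (vec [set s]) = 1.
Proof.
rewrite dot_unit !inE eqxx; case: s => i b.
by rewrite -pair_eqE /= eqxx; case: b.
Qed.

Lemma vecD1 A s : s \in A -> vec A = vec (A :\ s) + vec [set s].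
Proof.
case: s => j b sA; apply/rowP => i; rewrite !mxE !inE -!pair_eqE /=.
have [->|_] := eqVneq i j; last by rewrite addr0.
by case: b sA => ->; case: (_ \in A).
Qed.

End SignedSets.

Arguments vec {n} A.
Arguments flip {n} s.
(** * Families of 4-sets pairwise meeting in three elements *)

Section FourSets.
Variables (T : finType) (F : {set {set T}}).
Implicit Types (A B X Y Z : {set T}).

Lemma card_injective_singletons (g : {set T} -> {set T}) B :
  {in F &, injective g} -> {in F, forall X, g X \subset B /\ #|g X| = 1} ->
  #|F| <= #|B|.
Proof.
move=> ginj gF; rewrite -(card_in_imset ginj).
apply: leq_trans (leq_imset_card set1 B); apply: subset_leq_card.
apply/subsetP => _ /imsetP[X XF ->]; have [+ /eqP/cards1P[x gx]] := gF X XF.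
by rewrite gx sub1set => xB; apply: imset_f.
Qed.

Hypothesis F4 : {in F, forall X, #|X| = 4}.

(** The petals [X :\: A] are distinct singletons of the cover outside the 3-set [A]. *)
Lemma sunflower_cover A : F != set0 -> #|A| = 3 ->
  {in F, forall X, A \subset X} -> #|F| + 3 <= #|cover F|.
Proof.
move=> /set0Pn[X0 X0F] A3 AF.
have Acov : A \subset cover F.
  by apply: subset_trans (AF _ X0F) (bigcup_sup _ X0F).
rewrite -(cardsID A (cover F)) (setIidPr Acov) A3 addnC leq_add2l.
apply: (@card_injective_singletons (fun X => X :\: A)) => [X Y XF YF XY | X XF].
  by rewrite -(setID X A) -(setID Y A) XY !(setIidPr (AF _ _)).
split; first by apply: setSD; apply: bigcup_sup.
by rewrite cardsD (setIidPr (AF _ XF)) A3 F4.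
Qed.

Hypothesis F3 : {in F &, forall X Y, X != Y -> #|X :&: Y| = 3}.

(** If [Z] misses a point of [X :&: Y], it has at most 2 points there, hence at least 3 + 3 - 2 = 4
    points in [X :|: Y]. *)
Lemma triple_sub X Y Z : X \in F -> Y \in F -> Z \in F -> X != Y ->
  (X :&: Y \subset Z) || (Z \subset X :|: Y).
Proof.
move=> XF YF ZF XY.
have [->|ZX] := eqVneq Z X; first by rewrite subsetIl.
have [->|ZY] := eqVneq Z Y; first by rewrite subsetIr.
case: (boolP (_ \subset Z)) => //= nZ.
have lt2 : #|Z :&: (X :&: Y)| < 3.
  rewrite -(F3 XF YF XY) proper_card // properE subsetIr /=.
  by apply: contra nZ => /subset_trans -> //; apply: subsetIl.
have := cardsUI (Z :&: X) (Z :&: Y).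
rewrite -setIUr -setIIr (F3 ZF XF ZX) (F3 ZF YF ZY) => h.
apply/setIidPl/eqP; rewrite eqEcard subsetIl /= (F4 ZF); lia.
Qed.

(** If [X] and [Y] meet in [A] and some [Z] does not contain [A], all members lie in the 5-set
    [X :|: Y], each missing one point of it. A point is missed by at most one member, so it lies in
    two of [X], [Y], [Z]. *)
Lemma sunflower_or_small : F != set0 ->
  (exists2 A : {set T}, #|A| = 3 & {in F, forall X, A \subset X}) \/
  [/\ #|F| <= 5, #|F| <= #|cover F| & {in cover F, forall x, 
     exists X Y, [/\ X \in F, Y \in F, X != Y, x \in X & x \in Y]}].
Proof.
move=> /set0Pn[X XF].
case: (boolP [forall Y in F, Y == X]) => [/forall_inP FX | ].
  left; have /card_gt0P[x xX] : 0 < #|X| by rewrite F4.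
  exists (X :\ x) => [|Y /FX/eqP ->]; last exact: subsetDl.
  by have := cardsD1 x X; rewrite xX F4 // => -[].
rewrite negb_forall_in => /exists_inP[Y YF YX].
rewrite eq_sym in YX; set A := X :&: Y; set B := X :|: Y.
case: (boolP [forall Z in F, A \subset Z]) => [/forall_inP FA | ].
  by left; exists A; rewrite ?F3.
rewrite negb_forall_in => /exists_inP[Z ZF AZ]; right.
have A3 : #|A| = 3 by apply: F3.
have B5 : #|B| = 5.
  by have := cardsUI X Y; rewrite -/A -/B A3 (F4 XF) (F4 YF); lia.
have ZX : Z != X by apply: contraNneq AZ => ->; apply: subsetIl.
have ZY : Z != Y by apply: contraNneq AZ => ->; apply: subsetIr.
have ZB : Z \subset B by have := triple_sub XF YF ZF YX; rewrite (negPf AZ).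
have FB W : W \in F -> W \subset B.
  move=> WF; have /orP[AW|//] := triple_sub XF YF WF YX.
  have /orP[ZXW|] := triple_sub ZF XF WF ZX; last first.
    by move=> /subset_trans; apply; rewrite subUset ZB subsetUl.
  (* Otherwise [W :&: X] contains the distinct 3-sets [A] and [Z :&: X]. *)
  suff -> : W = X by apply: subsetUl.
  apply/eqP; apply: contraT => WX; have := F3 WF XF WX.
  have AZX : ~~ (Z :&: X \subset A).
    apply: contra AZ => s; have : Z :&: X == A by rewrite eqEcard s A3 F3.
    by move=> /eqP <-; apply: subsetIl.
  suff /proper_card : A \proper W :&: X by rewrite A3 => + W3; rewrite W3.
  rewrite properE subsetI AW subsetIl /=.
  by apply: contra AZX; apply: subset_trans; rewrite subsetI ZXW subsetIr.
have FBD W : W \in F -> #|B :\: W| = 1.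
  by move=> WF; rewrite cardsD (setIidPr (FB W WF)) B5 F4.
have BK W : W \in F -> B :\: (B :\: W) = W.
  by move=> WF; rewrite setDDr setDv set0U (setIidPr (FB W WF)).
have Finj : {in F &, injective (fun W => B :\: W)}.
  by move=> V W VF WF /= e; rewrite -(BK V VF) e BK.
have F5 : #|F| <= #|B|.
  by apply: (card_injective_singletons Finj) => W WF; rewrite subsetDl FBD.
split; first by rewrite -B5.
  apply: leq_trans F5 (subset_leq_card _).
  by rewrite subUset (bigcup_sup _ XF) (bigcup_sup _ YF).
move=> x /bigcupP[W /FB/subsetP xW /xW xB].
have xmiss V V' : V \in F -> V' \in F -> x \notin V -> x \notin V' -> V = V'.
  move=> VF V'F xV xV'; apply: Finj => //=.
  have miss U : U \in F -> x \notin U -> B :\: U = [set x].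
    move=> UF xU; apply/esym/eqP; rewrite eqEcard sub1set inE xU xB /=.
    by rewrite FBD // cards1.
  by rewrite !miss.
case: (boolP (x \in X)) => xX; last first.
  exists Y, Z; split; rewrite 1?eq_sym //; apply: contraT => x_miss.
    by rewrite (xmiss X Y) ?eqxx in YX.
  by rewrite (xmiss Z X) ?eqxx in ZX.
case: (boolP (x \in Y)) => xY; first by exists X, Y.
exists X, Z; split; rewrite 1?eq_sym //; apply: contraT => xZ.
by rewrite (xmiss Z Y) ?eqxx in ZY.
Qed.

End FourSets.

(** * Classes of an admissible family *)

(* [lia] would unfold the products while comparing them, and loops on the
   membership hypotheses. *)
Ltac lia_dot :=
  repeat match goal with |- context [dot ?u ?v] => generalize (dot u v) end;
  clear; lia.

Section Classes.
Local Open Scope ring_scope.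
Variables (n : nat) (M : {set {set 'I_n * bool}}).
Local Notation coord := ('I_n * bool)%type.
Local Notation class := {set {set coord}}.
Local Notation "A '.* B" := (dot (vec A) (vec B)) (at level 40).
Implicit Types (A B X Y : {set coord}) (C D : class) (s : coord).

Hypothesis M_consistent : {in M, forall A, consistent A}.
Hypothesis M4 : {in M, forall A, #|A| = 4%N}.
Hypothesis M_dot :
  {in M &, forall A B, A != B -> (A '.* B <= 0) || (A '.* B == 3)}.

Lemma dotMM A : A \in M -> A '.* A = 4.
Proof. by move=> AM; rewrite dot_vec_sub ?M4 ?M_consistent. Qed.

Definition near A B := 0 < A '.* B.

Lemma near_dot A B : A \in M -> B \in M -> near A B -> A != B -> A '.* B = 3.
Proof.
move=> AM BM nAB AB; have := M_dot AM BM AB.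
by rewrite leNgt [_ < _]nAB => /eqP.
Qed.

(* The vector [A + X - 2 B] has norm [2 (A . X)] and product [- 2] with [B]. *)
Lemma near_trans : {in M & &, forall B A X, near A B -> near B X -> near A X}.
Proof.
move=> B A X BM AM XM nAB nBX.
have [-> //|AB] := eqVneq A B; have [<- //|BX] := eqVneq B X.
have dAB := near_dot AM BM nAB AB; have dBX := near_dot BM XM nBX BX.
pose x := vec A + vec X + (- 2) *: vec B.
have xx : dot x x = 2 * (A '.* X).
  rewrite !dotE (dotC (vec B) (vec A)) (dotC (vec X) (vec A)).
  by rewrite (dotC (vec X) (vec B)) dAB dBX !dotMM //; lia.
have xB : dot x (vec B) = - 2.
  by rewrite !dotE (dotC (vec X)) dAB dBX dotMM.
rewrite /near lt_def; have := dot_ge0 x; rewrite xx => ge0.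
apply/andP; split; last by lia.
apply/eqP => AX0; rewrite AX0 mulr0 in xx.
by rewrite (dot_eq0 xx) dot0l in xB.
Qed.

Lemma near_equivalence : {in M & &, equivalence_rel near}.
Proof.
have sym A B : near A B = near B A by rewrite /near dotC.
move=> A B X AM BM XM; split=> [|AB]; first by rewrite /near dotMM.
by apply/idP/idP; apply: near_trans; rewrite // sym.
Qed.

Definition classes := equivalence_partition near M.
Definition classes_at s := [set C in classes | s \in cover C].

Lemma classes_partition : partition classes M.
Proof. exact: equivalence_partitionP near_equivalence. Qed.

Lemma class_mem C X : C \in classes -> X \in C -> X \in M.
Proof.
move=> CP XC; rewrite -(cover_partition classes_partition).
by apply/bigcupP; exists C.
Qed.

Lemma near_class C D X Y : C \in classes -> D \in classes -> X \in C ->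
  Y \in D -> near X Y = (C == D).
Proof.
move=> CP DP XC YD; have XM := class_mem CP XC; have YM := class_mem DP YD.
rewrite -(pblock_equivalence_partition near_equivalence) //.
have /and3P[_ triv _] := classes_partition.
rewrite -eq_pblock ?(cover_partition classes_partition) //.
by rewrite (def_pblock triv CP XC) (def_pblock triv DP YD).
Qed.

Lemma dot_class C X Y : C \in classes -> X \in C -> Y \in C -> X != Y ->
  X '.* Y = 3.
Proof.
move=> CP XC YC; apply: near_dot; rewrite ?(class_mem CP) //.
by rewrite (near_class CP CP).
Qed.

Lemma dot_diff_class C D X Y : C \in classes -> D \in classes -> X \in C ->
  Y \in D -> C != D -> X '.* Y <= 0.
Proof.
move=> CP DP XC YD CD.
by rewrite leNgt [_ < _](near_class CP DP) // (negPf CD).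
Qed.

Lemma class_card4 C : C \in classes -> {in C, forall X, #|X| = 4%N}.
Proof. by move=> CP X /(class_mem CP)/M4. Qed.

Lemma class_neq0 C : C \in classes -> C != set0.
Proof.
by have /and3P[_ _ P0] := classes_partition; apply: contraTneq => ->.
Qed.

(** The product 3 is the number of agreements, at most 3, minus the number of opposite signs. *)
Lemma class_setI C X Y : C \in classes -> X \in C -> Y \in C -> X != Y ->
  #|X :&: Y| = 3%N /\ X :&: flip @^-1: Y = set0.
Proof.
move=> CP XC YC XY; have := dot_class CP XC YC XY; rewrite dot_vec => d.
suff le3 : (#|X :&: Y| <= 3)%N by split; [lia | apply: cards0_eq; lia].
have X4 := class_card4 CP XC; have Y4 := class_card4 CP YC.
rewrite -ltnS -X4 proper_card // properE subsetIl; apply: contra XY => h.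
by rewrite eqEcard X4 Y4 andbT; apply: subset_trans h (subsetIr _ _).
Qed.

Lemma class_card3 C :
  C \in classes -> {in C &, forall X Y, X != Y -> #|X :&: Y| = 3%N}.
Proof. by move=> CP X Y XC YC XY; have [] := class_setI CP XC YC XY. Qed.

Lemma class_cover C : C \in classes -> (#|C| <= #|cover C|)%N.
Proof.
move=> CP; have C0 := class_neq0 CP.
have [[A A3 AC]|[]//] := sunflower_or_small (class_card4 CP) (class_card3 CP) C0.
exact: leq_trans (leq_addr _ _) (sunflower_cover (class_card4 CP) C0 A3 AC).
Qed.

Lemma sum_cover :
  (\sum_(C in classes) #|cover C| = \sum_s #|classes_at s|)%N.
Proof.
under eq_bigr do rewrite -sum1_card.
under [RHS]eq_bigr do rewrite -sum1_card.
rewrite (exchange_big_dep predT) //=; apply: eq_bigr => s _.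
by apply: eq_bigl => C; rewrite inE.
Qed.

(** The default [set0] is returned only when no member of [C] contains [s]. *)
Definition member_at s C := odflt set0 [pick X in C | s \in X].

Lemma member_atP s C : C \in classes_at s ->
  [/\ C \in classes, member_at s C \in C & s \in member_at s C].
Proof.
rewrite inE /member_at => /andP[CP /bigcupP[X XC sX]].
case: pickP => [Y /andP[]|] //.
by move=> /(_ X); rewrite XC sX.
Qed.

Lemma dot_unit_mem s C X : C \in classes -> X \in C -> s \in X ->
  [set s] '.* X = 1.
Proof.
by move=> CP XC; apply: dot_unit_in; apply: M_consistent; apply: class_mem XC.
Qed.

Lemma classes_at_le4 s : (#|classes_at s| <= 4)%N.
Proof.
have := @sum_coord_le n _ (classes_at s) (fun C => vec (member_at s C)) _
  1 (fun=> 4) (dot_unit1 s).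
rewrite sumr_const expr2 mul1r => h.
have : (#|classes_at s| * #|classes_at s|)%:R <= (4 * #|classes_at s|)%:R :> int.
  rewrite !natrM [4%:R * _]mulr_natr; apply: h.
    move=> C D /member_atP[CP mC _] /member_atP[DP mD _].
    exact: dot_diff_class CP DP mC mD.
  move=> C /member_atP[CP mC sm]; rewrite (dot_unit_mem CP) // dotMM //.
  exact: class_mem mC.
by rewrite ler_nat leq_mul2r; case: #|_|.
Qed.

(* Otherwise replace the member [X] of its class by [(X + Y) / 2], of norm 7/2:
   the four representatives would have a sum of norm at most 31/2 and of
   coordinate 4. *)
Lemma classes_at4_unique s C X Y : #|classes_at s| = 4%N -> C \in classes ->
  X \in C -> Y \in C -> s \in X -> s \in Y -> X = Y.
Proof.
move=> N4 CP XC YC sX sY; apply/eqP; apply: contraT => XY.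
have Cs : C \in classes_at s by rewrite inE CP; apply/bigcupP; exists X.
(* All is doubled to stay in the integers: the norms are 4 + 4 + 6 = 14 and 16, and 8 squared
   exceeds 14 + 48. *)
pose z D := if D == C then vec X + vec Y else 2 *: vec (member_at s D).
have z0 : {in classes_at s &, forall D E, D != E -> dot (z D) (z E) <= 0}.
  move=> D E /member_atP[DP mD _] /member_atP[EP mE _] DE; rewrite /z.
  have dot0 := dot_diff_class.
  case: eqVneq => DC; case: eqVneq => EC; rewrite !dotE.
  - by rewrite DC EC eqxx in DE.
  - have := dot0 _ _ _ _ CP EP XC mE; have := dot0 _ _ _ _ CP EP YC mE.
    by rewrite eq_sym EC => /(_ isT) + /(_ isT); lia_dot.
  - have := dot0 _ _ _ _ DP CP mD XC; have := dot0 _ _ _ _ DP CP mD YC.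
    by rewrite DC => /(_ isT) + /(_ isT); lia_dot.
  - by have := dot0 _ _ _ _ DP EP mD mE DE; lia_dot.
have zq : {in classes_at s, forall D, dot (vec [set s]) (z D) = 2 /\
    dot (z D) (z D) = if D == C then 14 else 16}.
  move=> D Ds; have [DP mD sm] := member_atP Ds; rewrite /z.
  case: eqVneq => DC; rewrite !dotE.
    rewrite !(dot_unit_mem CP) // (dotC (vec Y)) (dot_class CP XC YC XY).
    by rewrite !dotMM ?(class_mem CP).
  by rewrite (dot_unit_mem DP) // dotMM // (class_mem DP).
have := sum_coord_le (dot_unit1 s) z0 zq.
rewrite N4 (bigD1 C) //= eqxx (eq_bigr (fun=> 16)) => [|D /andP[_ /negPf->]//].
rewrite (eq_bigl (mem (classes_at s :\ C))); last first.
  by move=> D; rewrite !inE andbC.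
by have := cardsD1 C (classes_at s); rewrite sumr_const Cs N4 add1n => -[<-].
Qed.

(** No subtraction truncates, by [class_cover] and [classes_at_le4]. *)
Definition deficit : nat :=
  (\sum_(C in classes) (#|cover C| - #|C|) + \sum_s (4 - #|classes_at s|))%N.

Lemma card_deficit : (#|M| + deficit = 8 * n)%N.
Proof.
rewrite (card_partition classes_partition) addnA -big_split /=.
rewrite (eq_bigr (fun C : class => #|cover C|)); last first.
  by move=> C /class_cover CP; rewrite subnKC.
rewrite sum_cover -big_split /= (eq_bigr (fun=> 4)) => [|s _]; last first.
  by rewrite subnKC // classes_at_le4.
by rewrite sum_nat_const card_prod card_ord card_bool; lia.
Qed.


(** * Big classes and their cores *)

Definition core C := \bigcap_(X in C) X.

(** Six members exclude the 5-set alternative and exceed the norm allowed in [dot_big_le0]. *)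
Definition big C := (C \in classes) && (5 < #|C|)%N.

Lemma bigW C : big C -> C \in classes.
Proof. by case/andP. Qed.

Lemma core_sub C X : X \in C -> core C \subset X.
Proof. exact: bigcap_inf. Qed.

Lemma big_core C : big C ->
  #|core C| = 3%N /\ {in C &, forall X Y, X != Y -> X :&: Y = core C}.
Proof.
case/andP=> CP C6; have C0 := class_neq0 CP.
have [[A A3 AC]|[]] := sunflower_or_small (class_card4 CP) (class_card3 CP) C0;
  last by rewrite leqNgt C6.
have AI X Y : X \in C -> Y \in C -> X != Y -> X :&: Y = A.
  move=> XC YC XY; apply/esym/eqP; rewrite eqEcard subsetI !AC //=.
  by rewrite A3 (class_card3 CP).
suff -> : core C = A by [].
apply/eqP; rewrite eqEsubset; apply/andP; split; last exact/bigcapsP.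
have /card_gt1P[X [Y [XC YC XY]]] : (1 < #|C|)%N by lia.
by rewrite -(AI X Y) // subsetI !core_sub.
Qed.

Lemma core_consistent C : big C -> consistent (core C).
Proof.
move=> bC; have /set0Pn[X XC] := class_neq0 (bigW bC).
apply: consistent_sub (core_sub XC).
exact: M_consistent (class_mem (bigW bC) XC).
Qed.

Lemma dot_core C : big C -> core C '.* core C = 3.
Proof.
move=> bC; rewrite dot_vec_sub ?core_consistent //.
by have [-> _] := big_core bC.
Qed.

Lemma dot_mem_core C X : big C -> X \in C -> X '.* core C = 3.
Proof.
move=> bC XC; rewrite dot_vec_sub ?core_sub //.
  by have [-> _] := big_core bC.
exact: M_consistent (class_mem (bigW bC) XC).
Qed.

Lemma dot_big_le0 C w : big C -> {in C, forall X, dot w (vec X) <= 0} ->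
  dot w w <= 5 -> dot w (vec (core C)) <= 0.
Proof.
move=> bC wC w5; apply: (@dot_core_le0 n _ C (fun X => vec X)) => //.
- exact: dot_core.
- move=> X XC; split; last exact: dot_mem_core.
  by rewrite dotMM // (class_mem (bigW bC)).
- by move=> X Y XC YC; apply: dot_class (bigW bC) XC YC.
- by apply: le_lt_trans w5 _; case/andP: bC => _; rewrite ltr_nat.
Qed.

Lemma mem_core_le0 C D X : big C -> D \in classes -> D != C -> X \in D ->
  X '.* core C <= 0.
Proof.
move=> bC DP DC XD; apply: dot_big_le0 => // [Y YC|].
  exact: dot_diff_class DP (bigW bC) XD YC DC.
by rewrite dotMM // (class_mem DP).
Qed.

Lemma core_core_le0 C D : big C -> big D -> D != C -> core D '.* core C <= 0.
Proof.
move=> bC bD DC; apply: dot_big_le0; rewrite ?dot_core // => Y YC.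
by rewrite dotC; apply: mem_core_le0 (bigW bC) _ YC; rewrite // eq_sym.
Qed.

(* At most 47 signed coordinates are [thin], and the at most 15 [small]
   sunflowers touch at most 20 signed coordinates each: 47 + 300 = 347. *)
Lemma wide_coordinate : (347 < n)%N -> (deficit < 48)%N ->
  exists i : 'I_n, forall b, #|classes_at (i, b)| = 4%N /\
    {in classes_at (i, b), forall C, big C}.
Proof.
rewrite /deficit => n_large def.
pose thin := [set s | (#|classes_at s| < 4)%N].
pose small := [set C in classes | (#|C| + 3 <= #|cover C|) && (#|C| <= 5)]%N.
(* A thin signed coordinate adds at least 1 to the deficit, a small sunflower at least 3. *)
have thin47 : (#|thin| <= 47)%N.
  rewrite -ltnS; apply: leq_ltn_trans def; apply: leq_trans (leq_addl _ _).
  rewrite -sum1_card [in leqRHS](bigID (mem thin)) /=.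
  apply: leq_trans (leq_addr _ _).
  by apply: leq_sum => s; rewrite inE subn_gt0.
have small15 : (#|small| * 3 <= 47)%N.
  rewrite -ltnS; apply: leq_ltn_trans def; apply: leq_trans (leq_addr _ _).
  rewrite -sum_nat_const [in leqRHS](bigID (mem small)) /=.
  apply: leq_trans (leq_addr _ _).
  rewrite [leqRHS](eq_bigl (mem small)) => [|C]; last first.
    by rewrite !inE; case: (C \in classes).
  apply: leq_sum => C; rewrite inE => /and3P[CP h _].
  by rewrite leq_subRL ?class_cover.
pose touched := \bigcup_(C in small) cover C.
have touched300 : (#|touched| <= 300)%N.
  apply: leq_trans (_ : #|small| * 20 <= _)%N; last first.
    by apply: (@leq_mul _ 20 15 20); rewrite // -ltnS -(@ltn_pmul2r 3).
  rewrite -sum_nat_const.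
  apply: leq_trans (_ : \sum_(C in small) #|cover C| <= _)%N.
    apply: (big_ind2 (fun (U : {set coord}) m => #|U| <= m)%N) => //.
      by rewrite cards0.
    move=> U p V q Up Vq.
    exact: leq_trans (leq_card_setU U V) (leq_add Up Vq).
  apply: leq_sum => C; rewrite inE => /and3P[CP _ C5].
  apply: leq_trans (leq_card_cover C) _.
  rewrite (eq_bigr (fun=> 4%N)) => [|X /(class_card4 CP)//].
  by rewrite sum_nat_const (leq_mul C5 (leqnn 4)).
have [i ibad] : exists i : 'I_n, i \notin fst @: (thin :|: touched).
  apply/existsP; rewrite -negb_forall; apply: contraL n_large => /forallP all.
  have sub : [set: 'I_n] \subset fst @: (thin :|: touched).
    by apply/subsetP => i _; apply: all.
  have := subset_leq_card sub; rewrite cardsT card_ord -leqNgt => le_n.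
  apply: leq_trans le_n (leq_trans (leq_imset_card _ _) _).
  apply: leq_trans (leq_card_setU _ _) _.
  exact: leq_add thin47 touched300.
exists i => b.
have : (i, b) \notin thin :|: touched.
  by apply: contra ibad => h; apply/imsetP; exists (i, b).
rewrite inE negb_or inE -leqNgt => /andP[N4 untouched].
have {}N4 : #|classes_at (i, b)| = 4%N.
  by apply/eqP; rewrite eqn_leq N4 classes_at_le4.
split=> // C; rewrite inE => /andP[CP iC]; rewrite /big CP ltnNge /=.
apply: contra untouched => C5; apply/bigcupP; exists C => //.
rewrite inE CP C5 andbT /=; have C0 := class_neq0 CP.
have [[A A3 AC]|[_ _ two]] :=
  sunflower_or_small (class_card4 CP) (class_card3 CP) C0.
  exact: (sunflower_cover (class_card4 CP) C0 A3 AC).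
(* A class on a 5-set has two members at [(i, b)], against [classes_at4_unique]. *)
have [X [Y [XC YC XY sX sY]]] := two _ iC.
by rewrite (classes_at4_unique N4 CP XC YC) ?eqxx in XY.
Qed.

Lemma vec_petal s C X : big C -> X \in C -> s \in X -> s \notin core C ->
  vec X = vec (core C) + vec [set s].
Proof.
move=> bC XC sX sC; rewrite (vecD1 sX).
suff -> : core C = X :\ s by [].
apply/eqP; rewrite eqEcard subsetD1 core_sub // sC /=.
have [-> _] := big_core bC.
by have := cardsD1 s X; rewrite sX (class_card4 (bigW bC) XC) add1n => -[<-].
Qed.

(** If [s] were in the core, two members of [C] would contain it, against [classes_at4_unique]. *)
Lemma big_at_petal s C : #|classes_at s| = 4%N -> C \in classes_at s -> big C ->
  exists2 X, X \in C & vec X = vec (core C) + vec [set s].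
Proof.
move=> N4 Cs bC; have [CP mC sm] := member_atP Cs.
exists (member_at s C) => //; apply: vec_petal => //.
have /card_gt1P[X [Y [XC YC]]] : (1 < #|C|)%N.
  by case/andP: bC => _; apply: leq_trans.
apply: contraNN => sC; apply/eqP.
exact: classes_at4_unique N4 CP XC YC (subsetP (core_sub XC) _ sC)
  (subsetP (core_sub YC) _ sC).
Qed.

(** Members of one class never carry opposite signs, by [class_setI]. *)
Lemma big_at_disjoint s C : big C -> C \in classes_at s ->
  C \in classes_at (flip s) -> False.
Proof.
move=> bC /member_atP[CP mC sm] /member_atP[_ mC' sm'].
have XY : member_at s C != member_at (flip s) C.
  have cm := M_consistent (class_mem CP mC).
  by apply: contraTneq (sm') => <-; apply: consistentP cm sm.
have [_ /setP/(_ s)] := class_setI CP mC mC' XY.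
by rewrite !inE sm sm'.
Qed.

(** * Cores around a wide coordinate *)

Section WideCoordinate.
Variable i : 'I_n.
Hypothesis i_wide : forall b, #|classes_at (i, b)| = 4%N /\
  {in classes_at (i, b), forall C, big C}.

Let wide b := classes_at (i, b).

Lemma wide_card b : #|wide b| = 4%N.
Proof. by have [] := i_wide b. Qed.

Lemma wide_big b C : C \in wide b -> big C.
Proof. by have [_] := i_wide b; apply. Qed.

Lemma wide_disjoint b C D : C \in wide b -> D \in wide (~~ b) -> C != D.
Proof.
move=> CK DK; apply: contraTneq (DK) => <-; apply/negP => CK'.
exact: big_at_disjoint (wide_big CK) CK CK'.
Qed.

(** Adding the petal [(i, b)], orthogonal to both cores, gives members of [C] and [D]; their
    product, at most 0, is that of the cores plus 1. *)
Lemma wide_core_le b C D : C \in wide b -> D \in wide b -> C != D ->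
  core C '.* core D <= - 1.
Proof.
move=> CK DK CD; have bC := wide_big CK; have bD := wide_big DK.
have [X XC eX] := big_at_petal (wide_card b) CK bC.
have [Y YD eY] := big_at_petal (wide_card b) DK bD.
have := dot_mem_core bC XC; have := dot_mem_core bD YD.
have := dot_diff_class (bigW bC) (bigW bD) XC YD CD.
rewrite eX eY !dotE !dot_core // dot_unit1 (dotC _ (vec [set (i, b)])); lia_dot.
Qed.

(** The norm of the sum is at most 4 * 3 - 12 = 0. *)
Lemma wide_sum0 b : \sum_(C in wide b) vec (core C) = 0.
Proof.
apply: dot_eq0; apply/eqP; rewrite eq_le dot_ge0 andbT.
have := @dot_sum_le n _ (wide b) (fun C => vec (core C)) (- 1) (@wide_core_le b).
rewrite (eq_bigr (fun=> 3)) => [|C /wide_big/dot_core //].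
by rewrite sumr_const wide_card.
Qed.

(** The products are nonpositive and sum to 0. *)
Lemma wide_orthogonal b w : {in wide b, forall C, dot w (vec (core C)) <= 0} ->
  {in wide b, forall C, dot w (vec (core C)) = 0}.
Proof.
move=> w0 C CK; apply/eqP; rewrite -oppr_eq0; apply/eqP; move: C CK.
apply: psumr_eq0P => [C CK|]; first by rewrite oppr_ge0 w0.
by rewrite sumrN -dot_sumr wide_sum0 dotC dot0l oppr0.
Qed.

(** Against the zero sum, [core C] has product 3 plus three terms at most - 1, so each is - 1. *)
Lemma wide_core_eq b C D : C \in wide b -> D \in wide b -> C != D ->
  core C '.* core D = - 1.
Proof.
move=> CK DK CD.
have sum0 : \sum_(E in wide b :\ C) (- 1 - core C '.* core E) = 0.
  have : dot (vec (core C)) (\sum_(E in wide b) vec (core E)) = 0.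
    by rewrite wide_sum0 dotC dot0l.
  rewrite dot_sumr (bigD1 C) //= dot_core ?(wide_big CK) //.
  rewrite (eq_bigl (mem (wide b :\ C))) => [|E]; last by rewrite !inE andbC.
  rewrite sumrB sumr_const; have := cardsD1 C (wide b).
  rewrite CK wide_card add1n => -[<-].
  by move: (\sum_(_ in _) _) => S; clear; lia.
have := psumr_eq0P _ sum0; move/(_ _ D); rewrite in_setD1 eq_sym CD DK.
move=> h; apply/esym/eqP; rewrite -subr_eq0; apply/eqP; apply: h => // E.
rewrite in_setD1 eq_sym => /andP[CE EK].
by rewrite subr_ge0 (wide_core_le CK EK CE).
Qed.

Lemma wide_core_orthogonal b C D : C \in wide b -> D \in wide (~~ b) ->
  core C '.* core D = 0.
Proof.
move=> CK; apply: wide_orthogonal => E EK.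
exact: core_core_le0 (wide_big EK) (wide_big CK) (wide_disjoint CK EK).
Qed.

Definition wide_classes := wide true :|: wide false.

Lemma wide_classesP C : reflect (exists b, C \in wide b) (C \in wide_classes).
Proof.
rewrite inE; apply: (iffP orP) => [[]|[[]]];
  by [exists true | exists false | left | right].
Qed.

Lemma card_wide_classes : #|wide_classes| = 8%N.
Proof.
rewrite cardsU !wide_card (_ : _ :&: _ = set0) ?cards0 //.
apply/setP => C; rewrite in_set0 in_setI; apply/negP => /andP[Ct Cf].
by have := wide_disjoint Ct Cf; rewrite eqxx.
Qed.

Definition core_at s := [set C in wide_classes | s \in core C].

Lemma core_at_sub s : core_at s \subset classes_at s.
Proof.
apply/subsetP => C; rewrite in_set => /andP[/wide_classesP[b /wide_big bC] sC].
rewrite in_set bigW //=; have /set0Pn[X XC] := class_neq0 (bigW bC).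
by apply/bigcupP; exists X => //; apply: (subsetP (core_sub XC)).
Qed.

Lemma dot_unit_core s C : big C -> s \in core C -> [set s] '.* core C = 1.
Proof. by move=> bC; apply: dot_unit_in; apply: core_consistent. Qed.

(* Two cores of [wide b] containing [s] sum to twice the unit vector of [s]. *)
Lemma same_side s b C D w : C \in wide b -> D \in wide b -> C != D ->
  s \in core C -> s \in core D -> dot (vec [set s]) w = 1 ->
  dot w (vec (core C)) <= 0 -> dot w (vec (core D)) <= 0 -> False.
Proof.
move=> CK DK CD sC sD sw wC wD; have bC := wide_big CK; have bD := wide_big DK.
pose x := vec (core C) + vec (core D) + (- 2) *: vec [set s].
have xx : dot x x = 0.
  rewrite !dotE (dotC (vec (core D)) (vec (core C))).
  rewrite dot_unit1 !(dotC _ (vec [set s])) !dot_unit_core // !dot_core //.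
  by rewrite (wide_core_eq CK DK CD).
have : dot x w = 0 by rewrite (dot_eq0 xx) dot0l.
rewrite !dotE sw !(dotC _ w); move: wC wD; lia_dot.
Qed.

(* With [m] the member of [E] at [s], [F] a core of the side of [C] containing
   [flip s] and [e] the unit vector of [s], either [m] is not obtuse to one of
   the cores or [2 (m + C + D) - 7 e - F] has norm [- 2]. *)
Lemma opposite_sides s b C D E : C \in wide b -> D \in wide (~~ b) ->
  s \in core C -> s \in core D -> E \in classes_at s -> E \notin core_at s -> False.
Proof.
move=> CK DK sC sD /member_atP[EP mE sm] Es.
have bC := wide_big CK; have bD := wide_big DK.
case: (boolP (E \in wide_classes)) => [EK|EKK].
  have sE : s \notin core E by apply: contra Es => sE; rewrite inE EK.
  have {EK}/wide_classesP[c EK] := EK; have bE := wide_big EK.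
  (* The member of [E] at [s] is the core of [E] plus the petal [s]; its product with a core of the
     other side containing [s] would be 0 + 1. *)
  have side c' F : E \in wide c' -> F \in wide (~~ c') -> s \in core F -> False.
    move=> Ec Fc sF; have bF := wide_big Fc.
    have := mem_core_le0 bF EP (wide_disjoint Ec Fc) mE.
    rewrite (vec_petal bE mE sm sE) dotDl (wide_core_orthogonal Ec Fc).
    by rewrite dot_unit_core.
  have [cb|cb] := eqVneq c b.
    by rewrite cb in EK; apply: side EK DK sD.
  have {}cb : c = ~~ b by move: cb; case: (c); case: (b).
  by apply: side EK _ sC; rewrite cb negbK.
have mem_orth c F : F \in wide c -> member_at s E '.* core F = 0.
  move: F; apply: wide_orthogonal => F FK; apply: mem_core_le0 mE => //.
    exact: wide_big FK.
  by apply: contraNneq EKK => ->; apply/wide_classesP; exists c.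
(* The cores of a side sum to 0 and [core C] has product 1 with the unit vector of [s], so some core
   has a negative one. *)
have [F FK Fs] : exists2 F, F \in wide b & [set s] '.* core F < 0.
  apply/exists_inP; apply: contraT; rewrite negb_exists_in => /forall_inP neg.
  have w0 : {in wide b, forall F, dot ((- 1) *: vec [set s]) (vec (core F)) <= 0}.
    by move=> F FK; rewrite dotZl mulN1r oppr_le0 leNgt neg.
  by have := wide_orthogonal w0 CK; rewrite dotZl dot_unit_core.
have bF := wide_big FK.
have {}Fs : [set s] '.* core F = - 1.
  by move: Fs; rewrite dot_unit; do 2 case: (_ \in _).
have CF : C != F by apply: contra_eq_neq Fs => <-; rewrite dot_unit_core.
(* The norm is 40 + 49 + 3 - 84 + 4 - 14 = - 2. *)
have := dot_ge0 (2 *: (vec (member_at s E) + vec (core C) + vec (core D))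
  + (- 7) *: vec [set s] + (- 1) *: vec (core F)).
have mm := dotMM (class_mem EP mE).
have CD := wide_core_orthogonal CK DK.
have FD := wide_core_orthogonal FK DK.
have eC := dot_unit_core bC sC; have eD := dot_unit_core bD sD.
rewrite !dotE dot_unit1 !(dotC _ (vec [set s])) (dot_unit_mem EP mE sm).
rewrite eC eD Fs !dot_core // mm.
rewrite !(dotC _ (vec (member_at s E))) !(mem_orth _ _ CK) !(mem_orth _ _ DK).
rewrite !(mem_orth _ _ FK) (dotC (vec (core D)) (vec (core C))) CD.
rewrite (dotC (vec (core D)) (vec (core F))) FD.
by rewrite (dotC (vec (core F)) (vec (core C))) (wide_core_eq CK FK CF).
Qed.

(** Taking cores, of norm 3, as representatives where they contain [s] improves the count to N^2 <=
    4 N - g. Only N = 3 with g >= 2 escapes it, and the two preceding lemmas exclude that case. *)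
Lemma classes_core_at s : (#|classes_at s| + #|core_at s| <= 4)%N.
Proof.
pose z C := vec (if C \in core_at s then core C else member_at s C).
have coreP C : C \in core_at s -> big C /\ s \in core C.
  by rewrite inE => /andP[/wide_classesP[b /wide_big]].
have z0 : {in classes_at s &, forall C D, C != D -> dot (z C) (z D) <= 0}.
  move=> C D /member_atP[CP mC _] /member_atP[DP mD _] CD; rewrite /z.
  case: ifP => Cs; case: ifP => Ds.
  - have [bC _] := coreP _ Cs; have [bD _] := coreP _ Ds.
    exact: core_core_le0 bD bC CD.
  - have [bC _] := coreP _ Cs; rewrite dotC.
    by apply: mem_core_le0 bC DP _ mD; rewrite eq_sym.
  - have [bD _] := coreP _ Ds; exact: mem_core_le0 bD CP CD mC.
  - exact: dot_diff_class CP DP mC mD CD.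
have ze : {in classes_at s, forall C, dot (vec [set s]) (z C) = 1}.
  move=> C /member_atP[CP mC sm]; rewrite /z; case: ifP => [/coreP[bC sC]|_].
    by rewrite dot_unit_core.
  by rewrite (dot_unit_mem CP).
have zq : {in classes_at s, forall C, dot (vec [set s]) (z C) = 1 /\
    dot (z C) (z C) = 4 - (C \in core_at s)%:R}.
  move=> C Cs; split; first exact: ze.
  rewrite /z; case: ifP => [/coreP[bC _]|_]; first by rewrite dot_core.
  by have [CP mC _] := member_atP Cs; rewrite dotMM ?(class_mem CP) // subr0.
have := sum_coord_le (dot_unit1 s) z0 zq.
have -> : \sum_(C in classes_at s) (4 - (C \in core_at s)%:R) =
    4 *+ #|classes_at s| - #|core_at s|%:R :> int.
  rewrite sumrB sumr_const; congr (_ - _).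
  rewrite -sum1_card natr_sum big_mkcond [RHS]big_mkcond /=; apply: eq_bigr => C _.
  have := subsetP (core_at_sub s) C; case: (C \in core_at s) => [->|] //.
  by case: ifP.
have := subset_leq_card (core_at_sub s); have := classes_at_le4 s.
move Ne : #|classes_at s| => N; move ge : #|core_at s| => g N4 gN.
rewrite mul1r => Ng.
case: (leqP (N + g) 4) => // Ng5.
have [N3 g2] : N = 3%N /\ (2 <= g)%N.
  by move: N4 gN Ng Ng5; clear; case: N => [|[|[|[|[|]]]]] //; rewrite expr2; lia.
have /card_gt1P[C [D [Cs Ds CD]]] : (1 < #|core_at s|)%N by rewrite ge.
have [E] : exists E, E \in classes_at s :\: [set C; D].
  apply/set0Pn; rewrite -card_gt0 cardsD subn_gt0 Ne N3 ltnS.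
  apply: leq_trans (subset_leq_card (subsetIr _ _)) _.
  by rewrite cards2; case: eqVneq.
rewrite in_setD in_set2 negb_or => /andP[/andP[EC ED] Es].
have two b C' D' E' : C' \in wide b -> D' \in wide b -> C' \in core_at s ->
    D' \in core_at s -> E' \in classes_at s -> C' != D' -> E' != C' -> E' != D' ->
    False.
  move=> CK DK C's D's E's CD' EC' ED'.
  have le0 F : F \in core_at s -> E' != F -> dot (z E') (vec (core F)) <= 0.
    move=> Fs EF; have := z0 E' F E's (subsetP (core_at_sub s) F Fs) EF.
    by rewrite {2}/z Fs.
  have [_ sC'] := coreP _ C's; have [_ sD'] := coreP _ D's.
  exact: same_side CK DK CD' sC' sD' (ze _ E's) (le0 _ C's EC') (le0 _ D's ED').
have [_ sC] := coreP _ Cs; have [_ sD] := coreP _ Ds.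
have inKK F : F \in core_at s -> exists b, F \in wide b.
  by rewrite in_set => /andP[/wide_classesP].
have [b CK] := inKK _ Cs; have [d DK] := inKK _ Ds.
have [db|db] := eqVneq d b.
  by rewrite db in DK; case: (two b C D E).
have {}db : d = ~~ b by move: db; case: (d); case: (b).
(* Here [C] and [D] are on opposite sides. If the core of [E] contains [s], then [E] shares a side
   with one of them; otherwise [opposite_sides] applies. *)
rewrite {}db in DK; case: (boolP (E \in core_at s)) => [Ec|]; last first.
  by move=> Ec; case: (opposite_sides CK DK sC sD Es Ec).
have sub := subsetP (core_at_sub s).
have [e EK] := inKK _ Ec; have [eb|eb] := eqVneq e b.
  by rewrite eb in EK; case: (two b C E D); rewrite ?sub // eq_sym.
have {}eb : e = ~~ b by move: eb; case: (e); case: (b).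
by rewrite eb in EK; case: (two (~~ b) D E C); rewrite ?sub // eq_sym.
Qed.

Lemma deficit_wide : (48 <= deficit)%N.
Proof.
rewrite /deficit (_ : 48 = 24 + 24)%N //; apply: leq_add.
  rewrite [leqRHS](bigID (mem wide_classes)) /=; apply: leq_trans (leq_addr _ _).
  rewrite [leqRHS](eq_bigl (mem wide_classes)) => [|C]; last first.
    by apply: andb_idl => /wide_classesP[b /wide_big/bigW].
  rewrite (_ : 24 = \sum_(C in wide_classes) 3)%N; last first.
    by rewrite sum_nat_const card_wide_classes.
  apply: leq_sum => C /wide_classesP[b /wide_big bC]; have CP := bigW bC.
  rewrite leq_subRL ?class_cover //.
  have [A3 _] := big_core bC.
  exact: (sunflower_cover (class_card4 CP) (class_neq0 CP) A3 (@core_sub C)).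
(* Counting incidences, the eight cores of size 3 give 24. *)
apply: leq_trans (_ : \sum_s #|core_at s| <= _)%N; last first.
  apply: leq_sum => s _.
  by rewrite leq_subRL ?classes_at_le4 ?classes_core_at.
under eq_bigr do rewrite -sum1_card.
rewrite (exchange_big_dep (mem wide_classes)) /= => [|s C _]; last first.
  by rewrite in_set => /andP[].
rewrite (eq_bigr (fun=> 3%N)) => [|C CK]; last first.
  have /wide_classesP[b /wide_big/big_core[<- _]] := CK; rewrite -sum1_card.
  by apply: eq_bigl => s; rewrite in_set CK.
by rewrite sum_nat_const card_wide_classes.
Qed.

End WideCoordinate.

Lemma card_admissible_le : (347 < n)%N -> (#|M| <= 8 * n - 48)%N.
Proof.
move=> n_large; have := card_deficit.
case: (leqP 48 deficit) => [def|/(wide_coordinate n_large)[i /deficit_wide def]];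
  by move: def; clear; lia.
Qed.

End Classes.

(** * From sign vectors to sets of signed coordinates *)

Section SignVectors.
Local Open Scope ring_scope.
Variable n : nat.
Implicit Types u v : signvec n.

Definition support u : {set 'I_n * bool} :=
  [set s | val (u s.1) == if s.2 then 1 else - 1].

Lemma vec_support u i : vec (support u) 0 i = val (u i).
Proof.
by rewrite mxE !inE /=; have := valP (u i); rewrite !inE => /or3P[]/eqP->.
Qed.

Lemma inner_support u v : inner u v = dot (vec (support u)) (vec (support v)).
Proof. by apply: eq_bigr => i _; rewrite !vec_support. Qed.

Lemma support_inj : injective support.
Proof.
move=> u v uv; apply/ffunP => i; apply: val_inj.
by rewrite -!vec_support uv.
Qed.

Lemma support_consistent u : consistent (support u).
Proof.
apply/pred0P => -[i b] /=; rewrite !inE /flip /=.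
by have := valP (u i); rewrite !inE => /or3P[]/eqP->; case: b.
Qed.

Lemma admissible_card_le (M : {set signvec n}) : (347 < n)%N -> admissible M ->
  (#|M| <= 8 * n - 48)%N.
Proof.
move=> n_large /andP[/forall_inP M4 /forall_inP M_inner].
rewrite -(card_imset (mem M) support_inj); apply: card_admissible_le => //.
- by move=> _ /imsetP[u _ ->]; apply: support_consistent.
- move=> _ /imsetP[u uM ->]; have /eqP := M4 u uM.
  rewrite inner_support dot_vec_sub ?support_consistent // => h.
  by apply/eqP; rewrite -(eqr_nat int) h.
move=> _ _ /imsetP[u uM ->] /imsetP[v vM ->]; rewrite (inj_eq support_inj) => uv.
have /forall_inP/(_ v vM)/implyP/(_ uv) := M_inner u uM.
by rewrite inner_support !inE => /or4P[||| /or3P[]] /eqP->.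
Qed.

End SignVectors.

(** * A family of size 8n - 48 *)

Section Construction.
Local Open Scope ring_scope.
Variable k : nat.

Definition sign_zero : sign0 := @SeqSub _ [:: 0; 1; - 1 : int] 0 isT.
Definition sign_of (b : bool) : sign0 :=
  if b then @SeqSub _ [:: 0; 1; - 1 : int] 1 isT
  else @SeqSub _ [:: 0; 1; - 1 : int] (- 1) isT.

(* Signs with product 1 on one of the first two triples of coordinates: two
   distinct ones on the same triple have inner product [- 1]. *)
Definition triple_signs (c a b : bool) : seq sign0 :=
  let t := [:: sign_of a; sign_of b; sign_of (a == b)] in
  if c then t else nseq 3 sign_zero ++ t.

(** In [p = (c, a, b, j)], [c] selects the triple and the sign of the petal, [a] and [b] fix the
    signs on the triple, and [j] places the petal. *)
Definition petal_vector (p : bool * bool * bool * 'I_k) : signvec (6 + k) :=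
  [ffun x => match split x with
             | inl y => nth sign_zero (triple_signs p.1.1.1 p.1.1.2 p.1.2) y
             | inr l => if l == p.2 then sign_of p.1.1.1 else sign_zero
             end].

Lemma inner_petal_vector c a b j c' a' b' j' :
  inner (petal_vector (c, a, b, j)) (petal_vector (c', a', b', j')) =
  (if c == c' then if (a == a') && (b == b') then 3 else - 1 else 0) +
  (if j == j' then if c == c' then 1 else - 1 else 0).
Proof.
rewrite /inner big_split_ord /=; congr (_ + _).
  under eq_bigr => y _ do rewrite !ffunE (unsplitK (inl y)) /=.
  rewrite !big_ord_recl big_ord0.
  by case: c a b c' a' b' => [] [] [] [] [] [].
under eq_bigr => l _ do rewrite !ffunE (unsplitK (inr l)) /=.
have [<-|jj'] := eqVneq j j'.
  rewrite (bigD1 j) //= eqxx big1 ?addr0; first by case: c c' => [] [].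
  by move=> l /negPf->; rewrite mul0r.
apply: big1 => l _; have [->|_] := eqVneq l j; last by rewrite mul0r.
by rewrite (negPf jj') mulr0.
Qed.

Lemma petal_vector_inj : injective petal_vector.
Proof.
move=> [[[c a] b] j] [[[c' a'] b'] j'] e.
have := inner_petal_vector c a b j c a b j.
(* The value 4 = 3 + 1 is reached only when all parameters agree. *)
rewrite {2}e inner_petal_vector !eqxx /=.
case: eqVneq => [<-|_]; case: eqVneq => [<-|_] //=; last by case: ifP.
by case: eqVneq => [<-|_] //; case: eqVneq => [<-|_].
Qed.

(** Distinct vectors have product 3 + 0, - 1 + 1 or - 1 + 0 on the same triple, and 0 or - 1 on
    different ones. *)
Lemma petal_vectors_admissible : admissible [set petal_vector p | p : _].
Proof.
apply/andP; split.
  apply/forall_inP => _ /imsetP[[[[c a] b] j] _ ->].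
  by rewrite inner_petal_vector !eqxx.
apply/forall_inP => _ /imsetP[[[[c a] b] j] _ ->].
apply/forall_inP => _ /imsetP[[[[c' a'] b'] j'] _ ->].
apply/implyP => ne; have {ne} : (c, a, b, j) != (c', a', b', j').
  by apply: contraNneq ne => ->.
rewrite inner_petal_vector -!pair_eqE /= -!pair_eqE /= -!pair_eqE /=.
by do 4 case: (_ == _).
Qed.

Lemma card_petal_vectors : #|[set petal_vector p | p : _]| = (8 * k)%N.
Proof.
by rewrite (card_imset _ petal_vector_inj) !card_prod !card_bool card_ord.
Qed.

End Construction.

Theorem theorem2 :
  exists n0 : nat, forall n : nat, n0 <= n ->
    \max_(M : {set signvec n} | admissible M) #|M| = 8 * n - 48.
Proof.
exists 348 => n n_large; apply/eqP; rewrite eqn_leq; apply/andP; split.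
  by apply/bigmax_leqP => M; apply: admissible_card_le.
(* Six coordinates carry the triples and the other [n - 6] the petals. *)
have <- : 6 + (n - 6) = n by rewrite subnKC //; apply: leq_trans n_large.
rewrite mulnDr addKn -card_petal_vectors.
exact: leq_bigmax_cond (petal_vectors_admissible _).
Qed.
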